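(* Let $e_1,\dots,e_m$ be any multigraph edge stream, $\alpha,\beta\in(0,1)$, $\Delta t\ge0$, and run MG-Triangle$(\alpha,\beta,\Delta t)$ as described in the context. For every time $t$, the output $\widehat W_t$ satisfies $\mathbf E[\widehat W_t]=|W_t|$, where $W_t$ is the set of wedges of the simple graph $G_t$ formed by the edges $e_s$, $\max(1,t-\Delta t)\le s\le t$.
   Context: A multigraph edge stream is a sequence $e_1,\dots,e_m$ of unordered pairs of distinct vertex ids; the same pair may occur several times. For $t'\le t$, $G[t',t]$ denotes the simple undirected graph whose edge set is the set of distinct pairs among $e_{t'},\dots,e_t$; $G_t=G[\max(1,t-\Delta t),t]$. A wedge is a path of length $2$, i.e. an unordered pair of distinct edges $\{(u,v),(u,w)\}$ sharing exactly one vertex $u$; its closing edge is $(v,w)$. $W(G)$ is the set of wedges of a simple graph $G$, and $W_t=W(G_t)$. $hash$ is a uniformly random function assigning to every edge and every wedge an independent uniform value in $(0,1)$; expectations are over $hash$ only. Algorithm MG-Triangle$(\alpha,\beta,\Delta t)$ keeps a set \textit{e-list} of edges, a set \textit{w-list} of wedges, and for each $w\in$ \textit{w-list} a bit $X_w$; all start empty. For each $t=1,\dots,m$, on seeing $e_t$: (1) Update: if $hash(e_t)\le\alpha$ and $e_t\notin$ \textit{e-list}, insert $e_t$ into \textit{e-list}, and for each wedge $w=\{e,e_t\}$ with $e\in$ \textit{e-list}, if $hash(w)\le\beta$ and $w\notin$ \textit{w-list}, insert $w$ into \textit{w-list} (with $X_w=0$). (2) For each $w=\{(u,v),(u,w')\}\in$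 \textit{w-list}: if $e_t$ is the closing edge $(v,w')$ set $X_w=1$; else if $e_t\in\{(u,v),(u,w')\}$ reset $X_w=0$. (3) Let $\mathcal W$ be the set of wedges in \textit{w-list} that belong to $W_t$; output $\widehat T_t=(\alpha^2\beta)^{-1}\sum_{w\in\mathcal W}X_w$, $\widehat W_t=(\alpha^2\beta)^{-1}|\mathcal W|$, and $\widehat\tau_t=3\widehat T_t/\widehat W_t$ (with $\widehat\tau_t=0$ if $\widehat W_t=0$). *)

(* Defs.v *)
From HB Require Import structures.
From mathcomp Require Import all_boot all_order all_algebra finmap.
From mathcomp Require Import all_classical all_reals all_analysis.

Set Implicit Arguments.
Unset Strict Implicit.
Unset Printing Implicit Defensive.

Import Order.TTheory GRing.Theory Num.Theory.
Import numFieldNormedType.Exports.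

Local Open Scope fset_scope.
Local Open Scope classical_set_scope.
Local Open Scope ring_scope.

Section Graph.
Variable V : choiceType.

Record edge := Edge { ends : {fset V}; _ : #|` ends| == 2%N }.

HB.instance Definition _ := [isSub for ends].
HB.instance Definition _ := [Choice of edge by <:].

Definition endpoints (w : {fset edge}) : {fset V} :=
  (\bigcup_(e <- w) ends e)%fset.

Definition shared (w : {fset edge}) : {fset V} :=
  [fset u in endpoints w | all (fun e : edge => u \in ends e) w].

Definition is_wedge (w : {fset edge}) : bool :=
  (#|` w| == 2%N) && (#|` shared w| == 1%N).

Record wedge := Wedge { legs : {fset edge}; _ : is_wedge legs }.

HB.instance Definition _ := [isSub for legs].
HB.instance Definition _ := [Choice of wedge by <:].

(* A simple graph is given by its finite set of edges. *)
Definition wedges (G : {fset edge}) : {fset wedge} :=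
  [fset w in pmap (insub : {fset edge} -> option wedge) (fpowerset G)].

Lemma in_wedges (G : {fset edge}) (w : wedge) :
  (w \in wedges G) = (legs w `<=` G)%fset.
Proof.
rewrite /wedges inE /= mem_pmap; apply/mapP/idP.
  case=> x; rewrite fpowersetE => xG; case: insubP => //= w' _ ew [->].
  by rewrite ew.
by move=> wG; exists (legs w); [rewrite fpowersetE | rewrite valK].
Qed.

(* For the wedge {(u,v),(u,w')}, the pair {v,w'}. *)
Definition closing_ends (w : wedge) : {fset V} :=
  (endpoints (legs w) `\` shared (legs w))%fset.

(* Times are 1-based: e_s is the entry of index s - 1 of the stream. *)
Definition interval_graph (stream : seq edge) (t' t : nat) : {fset edge} :=
  [fset e in drop t'.-1 (take t stream)].

(* The truncated subtraction is harmless under the maximum with 1. *)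
Definition window_graph (stream : seq edge) (Dt t : nat) : {fset edge} :=
  interval_graph stream (maxn 1 (t - Dt)) t.

End Graph.

Section MGTriangle.
Variables (V : choiceType) (R : realType).
Variable hash : edge V + wedge V -> R.
Variables (alpha beta : R) (Dt : nat).

(* The bits are only meaningful on w_list; the value of X elsewhere is never
   used. *)
Record state := State {
  e_list : {fset edge V};
  w_list : {fset wedge V};
  X : wedge V -> bool }.

Definition init : state :=
  {| e_list := fset0; w_list := fset0; X := fun=> false |}.

Definition update (s : state) (e : edge V) : state :=
  if (hash (inl e) <= alpha) && (e \notin e_list s) then
    let el := (e |` e_list s)%fset in
    let new := [fset w in wedges el | [&& e \in legs w,
                  hash (inr w) <= beta & w \notin w_list s]] in
    {| e_list := el;
       w_list := (w_list s `|` new)%fset;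
       X := fun w => if w \in new then false else X s w |}
  else s.

Definition set_bits (s : state) (e : edge V) : state :=
  {| e_list := e_list s;
     w_list := w_list s;
     X := fun w => if w \notin w_list s then X s w
                   else if ends e == closing_ends w then true
                   else if e \in legs w then false
                   else X s w |}.

Definition step (s : state) (e : edge V) : state := set_bits (update s e) e.

Definition run (stream : seq (edge V)) (t : nat) : state :=
  foldl step init (take t stream).

Record output := Output { T_hat : R; W_hat : R; tau_hat : R }.

Definition MG_Triangle (stream : seq (edge V)) (t : nat) : output :=
  let s := run stream t in
  let W := (w_list s `&` wedges (window_graph stream Dt t))%fset in
  let That := (alpha ^+ 2 * beta)^-1 * \sum_(w <- W) (X s w)%:R in
  let What := (alpha ^+ 2 * beta)^-1 * (#|` W|)%:R in
  {| T_hat := That;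
     W_hat := What;
     tau_hat := if What == 0 then 0 else 3 * That / What |}.

End MGTriangle.

Section RandomHash.
Context {d : measure_display} {Omega : measurableType d} {R : realType}.
Variable P : probability Omega R.

Definition mutually_independent (I : choiceType) (Y : I -> {RV P >-> R}) : Prop :=
  forall (J : {fset I}) (A : I -> set R),
    (forall i, i \in J -> measurable (A i)) ->
    P (\bigcap_(i in [set` J]) (Y i @^-1` A i)) =
    (\prod_(i <- J) P (Y i @^-1` A i))%E.

Definition uniform01 (Y : {RV P >-> R}) : Prop :=
  (forall x, 0 < Y x < 1) /\
  (forall A : set R, measurable A -> distribution P Y A = uniform_prob (@ltr01 R) A).

Definition random_hash (V : choiceType)
    (hash : edge V + wedge V -> {RV P >-> R}) : Prop :=
  (forall k, uniform01 (hash k)) /\ mutually_independent hash.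

End RandomHash.

(* Main.v *)
(** A wedge [w] inside the window is stored at time [t] exactly when both its
    legs hash to at most [alpha] and [w] itself hashes to at most [beta],
    whatever the multiplicities and the order of the stream. These three events
    are independent, so each wedge of the window survives with probability
    [alpha ^+ 2 * beta], and linearity of expectation concludes. *)
Require Import Defs.
From mathcomp Require Import all_boot all_order all_algebra finmap.
From mathcomp Require Import all_classical all_reals all_analysis.
From mathcomp Require Import measurable_realfun.

Import Order.TTheory GRing.Theory Num.Theory.

Local Open Scope ring_scope.

Lemma uniform_prob_itvNyc (R : realType) (a b c : R) (ab : a < b) :
  a <= c <= b ->
  uniform_prob ab `]-oo, c]%classic = ((c - a) / (b - a))%:E.
Proof.
move=> /andP[ac cb]; rewrite /uniform_prob integral_uniform_pdf.
have -> : (`]-oo, c] `&` `[a, b] = `[a, c])%classic.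
  apply/seteqP; split=> x /=; rewrite !in_itv/=.
    by move=> [-> /andP[-> _]].
  by move=> /andP[-> xc]; rewrite xc (le_trans xc cb).
rewrite (eq_integral (fun=> (b - a)^-1%:E)); last first.
  move=> x; rewrite inE/= in_itv/= /uniform_pdf => /andP[-> xc].
  by rewrite (le_trans xc cb).
rewrite integral_cst//= lebesgue_measure_itv/= lte_fin.
(* The interval length is given by a conditional on [a < c], so the degenerate case [c = a] is
   treated apart. *)
move: ac; rewrite le_eqVlt => /predU1P[->|ac].
  by rewrite ltxx subrr mul0r mule0.
by rewrite ac -EFinD -EFinM mulrC.
Qed.

Lemma prob_uniform01_le (d : measure_display) (Omega : measurableType d)
    (R : realType) (P : probability Omega R) (Y : {RV P >-> R}) (c : R) :
  uniform01 Y -> 0 <= c <= 1 ->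
  P (Y @^-1` `]-oo, c])%classic = c%:E.
Proof.
move=> [_ Y01] c01.
have := Y01 `]-oo, c]%classic (measurable_itv _).
by rewrite uniform_prob_itvNyc// !subr0 divr1.
Qed.

Section Sampling.
Context {V : choiceType} {R : realType}.
Variable hash : edge V + wedge V -> R.
Variables (alpha beta : R).

Definition sampled (w : wedge V) : bool :=
  all (fun e => hash (inl e) <= alpha) (legs w) && (hash (inr w) <= beta).

(** Invariant of the run. Hash values are fixed, so a repeated edge gets the same verdict as its
    first occurrence, and a wedge is tested when its later leg enters [e_list]. Relating [w_list] to
    [e_list] rather than to [s] keeps the induction step local to one insertion. *)
Lemma run_lists (s : seq (edge V)) :
  let st := foldl (step hash alpha beta) (init V) s in
  (forall e, (e \in e_list st) = (e \in s) && (hash (inl e) <= alpha)) /\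
  (forall w, (w \in w_list st) =
             (legs w `<=` e_list st)%fset && (hash (inr w) <= beta)).
Proof.
elim/last_ind: s => [|s e]/=.
  split=> [e|w]; first by rewrite in_fset0.
  rewrite in_fset0; apply/esym/negbTE; rewrite fsubset0 negb_and.
  apply/orP; left; apply/eqP => w0.
  by have := valP w; rewrite /is_wedge /= w0 cardfs0.
rewrite foldl_rcons; set st := foldl _ _ _ => -[IHe IHw].
rewrite /step/= /update; case: ifPn => /=; last first.
  rewrite negb_and negbK => h; split=> // e'.
  rewrite mem_rcons inE IHe; case: eqVneq => //= ->.
  move: h; rewrite IHe; case: (hash (inl e) <= alpha); last by rewrite andbF.
  by rewrite /= andbT => ->.
move=> /andP[he el]; split=> [e'|w].
  by rewrite mem_rcons !inE IHe; case: eqVneq => //= ->; rewrite he.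
rewrite in_fsetU in_fset inE /= in_wedges IHw.
case: (hash (inr w) <= beta); last by rewrite !(andbF, andbT).
(* If the fresh edge [e] is a leg of [w], then [w] cannot have been stored before, and [new]
   decides. Otherwise [new] ignores [w], and adding [e] does not affect whether its legs are
   stored. *)
rewrite !andbT /=; have [ew|ew] := boolP (e \in legs w).
  have -> : (legs w `<=` e_list st)%fset = false.
    by apply/negbTE/negP => /fsubsetP/(_ _ ew); rewrite (negbTE el).
  by rewrite /= andbT.
rewrite andbF orbF; apply/fsubsetP/fsubsetP => sub e' e'w.
  by rewrite !inE sub ?orbT.
move: (sub _ e'w); rewrite !inE => /predU1P[e'e|//].
by rewrite -e'e e'w in ew.
Qed.

(** Legs inside the window have already occurred by time [t], so only the hash conditions of the
    invariant remain. *)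
Lemma mem_w_list_run (stream : seq (edge V)) (Dt t : nat) (w : wedge V) :
  w \in wedges (window_graph stream Dt t) ->
  (w \in w_list (run hash alpha beta stream t)) = sampled w.
Proof.
rewrite in_wedges => /fsubsetP wG.
have [el wl] := run_lists (take t stream).
rewrite /run wl /sampled; congr (_ && _).
apply/fsubsetP/allP => h e ew; have := h e ew; rewrite el.
  by case/andP.
by move=> ->; rewrite andbT; have := wG e ew; rewrite !inE => /mem_drop.
Qed.

(** The index set on the right does not depend on [hash]: all randomness sits in the summands, ready
    for linearity. *)
Lemma W_hatE (Dt : nat) (stream : seq (edge V)) (t : nat) :
  W_hat (MG_Triangle hash alpha beta Dt stream t) =
  (alpha ^+ 2 * beta)^-1 *
    \sum_(w <- wedges (window_graph stream Dt t)) (sampled w)%:R.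
Proof.
rewrite /MG_Triangle/=; congr (_ * _).
rewrite (eq_big_seq (fun w =>
    (w \in w_list (run hash alpha beta stream t))%:R)); last first.
  by move=> w /mem_w_list_run ->.
rewrite -natr_sum -big_mkcond /= big_fset_condE -card_fset_sum1.
by congr ((#|` _|%fset)%:R); apply/fsetP => w; rewrite in_fset !inE andbC.
Qed.

End Sampling.

Section Probability.
Context {d : measure_display} {Omega : measurableType d} {R : realType}.
Context {P : probability Omega R} {V : choiceType}.
Variable hash : edge V + wedge V -> {RV P >-> R}.
Hypothesis hhash : random_hash hash.
Variables (alpha beta : R).
Hypotheses (halpha : 0 <= alpha <= 1) (hbeta : 0 <= beta <= 1).

Let event (w : wedge V) : set Omega :=
  [set x | sampled (fun k => hash k x) alpha beta w]%classic.

Let threshold (k : edge V + wedge V) : R := if k is inl _ then alpha else beta.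

(** Gathering legs and wedge in one index set turns the event into a single finite intersection, the
    shape required by [mutually_independent]. *)
Let keys (w : wedge V) : {fset edge V + wedge V} :=
  (inr w |` [fset inl e | e in legs w])%fset.

Let eventE w : event w =
  (\bigcap_(k in [set` keys w]) (hash k @^-1` `]-oo, threshold k]))%classic.
Proof.
apply/seteqP; split=> x /=.
  move=> /andP[/allP hl hw] k /=; rewrite in_fset1U => /predU1P[->|].
    by rewrite /= in_itv.
  by case/imfsetP => e /= /hl he ->; rewrite /= in_itv.
move=> h; apply/andP; split; last first.
  by have := h (inr w); rewrite /= in_itv; apply; rewrite fset1U1.
apply/allP => e ew; have := h (inl e); rewrite /= in_itv; apply.
by rewrite in_fset1U /=; apply/imfsetP; exists e.
Qed.

Lemma measurable_sampled w :
  measurable [set x | sampled (fun k => hash k x) alpha beta w]%classic.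
Proof.
rewrite -/(event w) eventE; apply: fin_bigcap_measurable => [|k _].
  exact: finite_fset.
by rewrite -[X in measurable X]setTI; exact: measurable_funPT.
Qed.

Lemma prob_sampled w :
  P [set x | sampled (fun k => hash k x) alpha beta w]%classic =
  (alpha ^+ 2 * beta)%:E.
Proof.
have [hU hI] := hhash.
rewrite -/(event w) eventE hI; last by [].
rewrite (eq_bigr (fun k => (threshold k)%:E)); last first.
  by move=> [e|w'] _; exact: prob_uniform01_le.
rewrite prodEFin; congr EFin.
(* The keys are distinct, so the product has one factor [beta] and one factor [alpha] per leg; a
   wedge has two legs. *)
rewrite big_fsetU1/=; last first.
  by apply/negP => /imfsetP[].
rewrite big_imfset/=; last by move=> ? ? _ _ [].
have /andP[/eqP w2 _] := valP w.
by rewrite big_const_seq count_predT w2 /= mulr1 mulrC.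
Qed.

End Probability.

Theorem theorem3p3 (d : measure_display) (Omega : measurableType d)
    (R : realType) (P : probability Omega R) (V : choiceType)
    (m : nat) (stream : m.-tuple (edge V))
    (alpha beta : R) (Dt : nat)
    (halpha : 0 < alpha < 1) (hbeta : 0 < beta < 1)
    (hash : edge V + wedge V -> {RV P >-> R})
    (hhash : random_hash hash)
    (t : nat) (ht : (1 <= t <= m)%N) :
  ('E_P[(fun x => W_hat (MG_Triangle (fun k => hash k x) alpha beta Dt stream t))]
   = (#|` wedges (window_graph stream Dt t)|%fset)%:R%:E)%E.
Proof.
have ha : 0 <= alpha <= 1 by case/andP: halpha => /ltW -> /ltW ->.
have hb : 0 <= beta <= 1 by case/andP: hbeta => /ltW -> /ltW ->.
case/andP: halpha hbeta => a0 _ /andP[b0 _].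
have c0 : 0 < alpha ^+ 2 * beta by rewrite mulr_gt0// exprn_gt0.
pose S w : set Omega :=
  [set x | sampled (fun k => hash k x) alpha beta w]%classic.
have mS w : measurable (S w) by exact: measurable_sampled.
rewrite unlock.
under eq_integral => x _.
  rewrite W_hatE EFinM -sumEFin.
  under eq_bigr => w _.
    have -> : (sampled (hash ^~ x) alpha beta w)%:R = \1_(S w) x :> R.
      by rewrite indicE; congr (_%:R); congr nat_of_bool; apply/idP/idP;
        rewrite inE.
    over.
  over.
(* All terms are nonnegative, so linearity needs measurability only, not integrability. *)
rewrite ge0_integralZl_EFin//=; last 3 first.
- by move=> x _; apply: sume_ge0 => w _; rewrite lee_fin.
- apply: emeasurable_sum => w.
  by apply/measurable_EFinP; exact: measurable_indic.
- by rewrite invr_ge0 ltW.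
rewrite ge0_integral_sum//; last first.
  by move=> w; apply/measurable_EFinP; exact: measurable_indic.
rewrite (eq_bigr (fun=> (alpha ^+ 2 * beta)%:E)) => [|w _]; last first.
  by rewrite integral_indic// setIT; exact: prob_sampled.
(* Every wedge contributes the same mass, which the normalising factor cancels since [c0] makes it
   nonzero. *)
rewrite sumEFin -EFinM; congr EFin.
by rewrite big_const_seq count_predT iter_addr_0 mulrnAr mulVf ?gt_eqF//.
Qed.
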